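(* Let $V_k=\gamma/k^\alpha$. (i) Let $m\ge1$, $n=2m$, and let $\mathcal{S}_m\subset\mathcal{S}_n\subset\mathcal{T}$ be nested subsets of sizes $m,n$ with regularized risks $R_m,R_n$ and minimizers $\mathbf{w}_m^*,\mathbf{w}_n^*$. Let $\mathbf{w}_m$ satisfy $\mathbb{E}[R_m(\mathbf{w}_m)-R_m(\mathbf{w}_m^* )]\le V_m$. Run accelerated gradient descent on $R_n$: $\tilde{\mathbf{w}}_0=\tilde{\mathbf{y}}_0=\mathbf{w}_m$ and $$\tilde{\mathbf{w}}_{k+1}=\tilde{\mathbf{y}}_k-\eta_n\nabla R_n(\tilde{\mathbf{y}}_k),\qquad \tilde{\mathbf{y}}_{k+1}=\tilde{\mathbf{w}}_{k+1}+\beta_n(\tilde{\mathbf{w}}_{k+1}-\tilde{\mathbf{w}}_k),$$ with $\eta_n=\frac{1}{cV_n+M}$ and $\beta_n=\frac{\sqrt{cV_n+M}-\sqrt{cV_n}}{\sqrt{cV_n+M}+\sqrt{cV_n}}$, and set $\mathbf{w}_n=\tilde{\mathbf{w}}_{s_n}$. If $$s_n\ge\sqrt{\frac{n^\alpha M+c\gamma}{c\gamma}}\,\log\left[6\cdot2^\alpha+(2^\alpha-1)\left(4+c\|\mathbf{w}^*\|^2\right)\right],$$ then $\mathbb{E}[R_n(\mathbf{w}_n)-R_n(\mathbf{w}_n^* )]\le V_n$. (ii) Moreover, suppose $N=2^q m_0$ for an integer $q\ge0$ and the sample sizes $n\in\{m_0,2m_0,\dots,N\}$ are used in turn (each stage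 initialized at the output of the previous one), with $s_n$ equal to the right-hand side of the bound in (i) at each stage, and where one AGD iteration on $R_n$ is counted as $n$ component-gradient evaluations. Then the total number of gradient evaluations $\sum_{n\in\{m_0,2m_0,\dots,N\}} n\,s_n$ is at most $$N\left[1+\log_2\!\left(\frac{N}{m_0}\right)+\frac{\sqrt{2^\alpha}}{\sqrt{2^\alpha}-1}\sqrt{\frac{N^\alpha M}{c\gamma}}\right]\log\left[6\cdot2^\alpha+(2^\alpha-1)\left(4+c\|\mathbf{w}^*\|^2\right)\right].$$
   Context: Let $Z$ be a random variable with distribution $P$ on a space $\mathcal{Z}$ and $f:\mathbb{R}^p\times\mathcal{Z}\to\mathbb{R}$ a loss function. The expected loss is $L(\mathbf{w})=\mathbb{E}_Z[f(\mathbf{w},Z)]$ and $\mathbf{w}^*$ denotes a minimizer of $L$. The training set $\mathcal{T}=\{z_1,\dots,z_N\}$ consists of $N$ independent samples from $P$. For a (fixed, data-independent) subset $\mathcal{S}\subseteq\mathcal{T}$ with $k$ elements, the empirical loss is $L_{\mathcal{S}}(\mathbf{w})=\frac1k\sum_{z\in\mathcal{S}}f(\mathbf{w},z)$; for the sets $\mathcal{S}_k$ we write $L_k=L_{\mathcal{S}_k}$. Statistical accuracy: $V_k=\gamma/k^\alpha$ with constants $\gamma>0$, $\alpha\in[0.5,1]$, and for every $k$ and every set $\mathcal{S}$ of $k$ independent samples from $P$, $\mathbb{E}[\sup_{\mathbf{w}}|L(\mathbf{w})-L_{\mathcal{S}}(\mathbf{w})|]\le V_k$. For a constant $c>0$,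 $R_k(\mathbf{w})=L_k(\mathbf{w})+\frac{cV_k}{2}\|\mathbf{w}\|^2$ with minimizer $\mathbf{w}_k^*$; thus $\nabla R_n(\mathbf{w})=\frac1n\sum_{z\in\mathcal{S}_n}\nabla f(\mathbf{w},z)+cV_n\mathbf{w}$. Assumption: for every $z$, $f(\cdot,z)$ is convex with $M$-Lipschitz continuous gradient ($M>0$). Expectations are over the training samples. *)

(* Defs.v *)
From HB Require Import structures.
From mathcomp Require Import all_boot all_order all_algebra.
From mathcomp Require Import all_classical all_reals all_analysis.
Set Implicit Arguments. Unset Strict Implicit. Unset Printing Implicit Defensive.
Import Order.TTheory GRing.Theory Num.Theory.
Import numFieldNormedType.Exports.
Local Open Scope classical_set_scope.
Local Open Scope ring_scope.

Section Defs.
Variable R : realType.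

Definition dotv (p : nat) (u v : 'rV[R]_p) : R := \sum_(i < p) u ord0 i * v ord0 i.
Definition enorm (p : nat) (v : 'rV[R]_p) : R := Num.sqrt (dotv v v).

Definition Vacc (gamma alpha : R) (k : nat) : R := gamma / (k%:R `^ alpha).

Definition convex_fun (p : nat) (h : 'rV[R]_p -> R) : Prop :=
  forall (x y : 'rV[R]_p) (t : R), 0 <= t <= 1 ->
    h ((1 - t) *: x + t *: y) <= (1 - t) * h x + t * h y.

Definition is_gradient (p : nat) (h : 'rV[R]_p -> R) (g : 'rV[R]_p -> 'rV[R]_p) : Prop :=
  forall w : 'rV[R]_p, differentiable h w /\ forall v, 'd h w v = dotv (g w) v.

Definition independent_rvs {dO dZ} {Omega : measurableType dO} {Z : measurableType dZ}
  (Pr : probability Omega R) (I : finType) (X : I -> Omega -> Z) : Prop :=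
  forall B : I -> set Z, (forall i, measurable (B i)) ->
    (Pr (\bigcap_(i in [set: I]) (X i @^-1` B i)) = \prod_(i : I) Pr (X i @^-1` B i))%E.

Definition has_law {dO dZ} {Omega : measurableType dO} {Z : measurableType dZ}
  (Pr : probability Omega R) (X : Omega -> Z) (P : probability Z R) : Prop :=
  forall B, measurable B -> Pr (X @^-1` B) = P B.

Definition Lexp {dZ} {Z : measurableType dZ} (p : nat) (P : probability Z R)
  (f : 'rV[R]_p -> Z -> R) (w : 'rV[R]_p) : R :=
  fine (\int[P]_z (f w z)%:E)%E.

Definition Lemp {dO dZ} {Omega : measurableType dO} {Z : measurableType dZ} (p N : nat)
  (f : 'rV[R]_p -> Z -> R) (z : 'I_N -> Omega -> Z) (S : {set 'I_N})
  (om : Omega) (w : 'rV[R]_p) : R :=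
  (#|S|%:R)^-1 * \sum_(i in S) f w (z i om).

Definition Rreg {dO dZ} {Omega : measurableType dO} {Z : measurableType dZ} (p N : nat)
  (gamma alpha c : R) (f : 'rV[R]_p -> Z -> R) (z : 'I_N -> Omega -> Z)
  (S : {set 'I_N}) (om : Omega) (w : 'rV[R]_p) : R :=
  Lemp f z S om w + c * Vacc gamma alpha #|S| / 2 * enorm w ^+ 2.

Definition gradRreg {dO dZ} {Omega : measurableType dO} {Z : measurableType dZ} (p N : nat)
  (gamma alpha c : R) (g : 'rV[R]_p -> Z -> 'rV[R]_p) (z : 'I_N -> Omega -> Z)
  (S : {set 'I_N}) (om : Omega) (w : 'rV[R]_p) : 'rV[R]_p :=
  (#|S|%:R)^-1 *: \sum_(i in S) g w (z i om) + (c * Vacc gamma alpha #|S|) *: w.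

Fixpoint agd (p : nat) (G : 'rV[R]_p -> 'rV[R]_p) (eta beta : R) (w0 : 'rV[R]_p)
  (k : nat) : 'rV[R]_p * 'rV[R]_p :=
  match k with
  | 0 => (w0, w0)
  | k'.+1 => let wy := agd G eta beta w0 k' in
             let w' := wy.2 - eta *: G wy.2 in
             (w', w' + beta *: (w' - wy.1))
  end.

Definition eta_n (gamma alpha c M : R) (n : nat) : R := (c * Vacc gamma alpha n + M)^-1.
Definition beta_n (gamma alpha c M : R) (n : nat) : R :=
  (Num.sqrt (c * Vacc gamma alpha n + M) - Num.sqrt (c * Vacc gamma alpha n)) /
  (Num.sqrt (c * Vacc gamma alpha n + M) + Num.sqrt (c * Vacc gamma alpha n)).

Definition logfac (p : nat) (alpha c : R) (wstar : 'rV[R]_p) : R :=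
  ln (6 * 2 `^ alpha + (2 `^ alpha - 1) * (4 + c * enorm wstar ^+ 2)).

Definition sbound (p : nat) (gamma alpha c M : R) (wstar : 'rV[R]_p) (n : nat) : R :=
  Num.sqrt ((n%:R `^ alpha * M + c * gamma) / (c * gamma)) * logfac alpha c wstar.

End Defs.

(* Main.v *)
Require Import Defs.
From HB Require Import structures.
From mathcomp Require Import all_boot all_order all_algebra.
From mathcomp Require Import all_classical all_reals all_analysis.
From mathcomp Require Import measurable_realfun ring lra.

(** Write D_S for the supremum over w of |L - L_S|.  Since L_n is the average of
    L_m and of the loss of the m samples in S_n \ S_m, the losses L_n and L_m
    differ by at most (D_{S_n \ S_m} + D_{S_m}) / 2; together with
    R_m(w_m^* ) <= R_m(w_n^* ) this bounds the R_n-suboptimality of w_m by its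
    R_m-suboptimality, the deviations, and c (V_m - V_n) / 2 |w_n^*|^2, where
    R_n(w_n^* ) <= R_n(w^* ) controls |w_n^*|^2 by |w^*|^2 and D_{S_n}.  In
    expectation the initial suboptimality is at most
    V_n [3 * 2^alpha + (2^alpha - 1) (2 + c / 2 |w^*|^2)].
    Accelerated gradient descent contracts the Lyapunov function
    F(x_k) - F^* + (mu / 2) |v_k - x^*|^2 by 1 - sqrt(mu / L) at every step, and
    this function is initially at most twice the suboptimality. *)

Set Implicit Arguments. Unset Strict Implicit. Unset Printing Implicit Defensive.
Import Order.TTheory GRing.Theory Num.Theory.
Import numFieldNormedType.Exports.
Local Open Scope classical_set_scope.
Local Open Scope ring_scope.

(** * Inner product and Euclidean norm on row vectors *)

Section Euclidean.
Context {R : realType} {p : nat}.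
Implicit Types (u v w : 'rV[R]_p) (a b : R).

Lemma dotvC u v : dotv u v = dotv v u.
Proof. by apply: eq_bigr => i _; rewrite mulrC. Qed.

Lemma dotvDl u v w : dotv (u + v) w = dotv u w + dotv v w.
Proof. by rewrite -big_split; apply: eq_bigr => i _; rewrite mxE mulrDl. Qed.

Lemma dotvZl a u v : dotv (a *: u) v = a * dotv u v.
Proof. by rewrite mulr_sumr; apply: eq_bigr => i _; rewrite mxE mulrA. Qed.

Lemma dotvNl u v : dotv (- u) v = - dotv u v.
Proof. by rewrite -scaleN1r dotvZl mulN1r. Qed.

Lemma dotv0l v : dotv 0 v = 0.
Proof. by rewrite -(scale0r v) dotvZl mul0r. Qed.

Lemma dotvDr u v w : dotv w (u + v) = dotv w u + dotv w v.
Proof. by rewrite dotvC dotvDl !(dotvC w). Qed.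

Lemma dotvZr a u v : dotv v (a *: u) = a * dotv v u.
Proof. by rewrite dotvC dotvZl (dotvC v). Qed.

Lemma dotvNr u v : dotv v (- u) = - dotv v u.
Proof. by rewrite dotvC dotvNl (dotvC v). Qed.

Definition dotvE := (dotvDl, dotvDr, dotvNl, dotvNr, dotvZl, dotvZr).

Lemma dotv_suml (I : finType) (A : {set I}) (u : I -> 'rV[R]_p) v :
  dotv (\sum_(i in A) u i) v = \sum_(i in A) dotv (u i) v.
Proof. apply: (big_morph (fun x => dotv x v)) => [x y|]; [exact: dotvDl|exact: dotv0l]. Qed.

Lemma dotvv_ge0 v : 0 <= dotv v v.
Proof. by apply: sumr_ge0 => i _; rewrite -expr2 sqr_ge0. Qed.

Lemma enorm_ge0 v : 0 <= enorm v.
Proof. exact: sqrtr_ge0. Qed.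

Lemma enorm_sqr v : enorm v ^+ 2 = dotv v v.
Proof. by rewrite sqr_sqrtr// dotvv_ge0. Qed.

Lemma dotv0_eq0 v : dotv v v <= 0 -> v = 0.
Proof.
move=> vv; apply/rowP => i; rewrite mxE; apply/eqP.
rewrite -sqrf_eq0 eq_le sqr_ge0 andbT.
apply: le_trans vv; rewrite /dotv (bigD1 i)//= expr2 lerDl.
by apply: sumr_ge0 => j _; rewrite -expr2 sqr_ge0.
Qed.

Lemma enorm_eq0 v : enorm v = 0 -> v = 0.
Proof. by move=> /eqP; rewrite sqrtr_eq0 => /dotv0_eq0. Qed.

(** Cauchy-Schwarz, from the nonnegative square of [enorm v *: u - enorm u *: v]. *)
Lemma dotv_le_enorm u v : dotv u v <= enorm u * enorm v.
Proof.
have [/enorm_eq0->|un0] := eqVneq (enorm u) 0.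
  by rewrite dotv0l mulr_ge0 ?enorm_ge0.
have [/enorm_eq0->|vn0] := eqVneq (enorm v) 0.
  by rewrite dotvC dotv0l mulr_ge0 ?enorm_ge0.
have uv : 0 < enorm u * enorm v by rewrite mulr_gt0// lt_def enorm_ge0 ?un0 ?vn0.
rewrite -(ler_pM2l uv).
have := dotvv_ge0 (enorm v *: u - enorm u *: v).
rewrite !dotvE (dotvC v u) -!enorm_sqr; nra.
Qed.

End Euclidean.

(** * First-order bounds for a convex function with Lipschitz gradient *)

Section SmoothConvex.
Context {R : realType} {p : nat}.
Variables (h : 'rV[R]_p -> R) (g : 'rV[R]_p -> 'rV[R]_p).
Hypothesis (hconv : convex_fun h) (hgrad : is_gradient h g).

(** The derivative along [y - x] is a limit of difference quotients from the right, and convexity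
    bounds each of them by [h y - h x]. *)
Lemma convex_gradient_le (x y : 'rV[R]_p) : h x + dotv (g x) (y - x) <= h y.
Proof.
have [hd hdg] := hgrad x.
rewrite -hdg -lerBrDl -deriveE//.
have /cvg_dnbhs_at_right dcv : e^-1 *: ((h \o shift x) (e *: (y - x)) - h x)
    @[e --> 0^'] --> 'D_(y - x) h x by exact: diff_derivable.
rewrite -(cvg_lim _ dcv)//; apply: limr_le; first by apply/cvg_ex; eexists; exact: dcv.
near=> t.
have t0 : 0 < t by near: t; exact: nbhs_right_gt.
have t1 : t <= 1 by near: t; exact: nbhs_right_le.
rewrite /= -[_ *: _]/(t^-1 * _) mulrC ler_pdivrMr//.
have -> : t *: (y - x) + x = (1 - t) *: x + t *: y.
  by apply/rowP => i; rewrite !mxE; ring.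
have := @hconv x y t; rewrite (ltW t0) t1 => /(_ isT); lra.
Unshelve. all: by end_near. Qed.

Hypothesis (M : R) (M0 : 0 < M).
Hypothesis (glip : forall w v, enorm (g w - g v) <= M * enorm (w - v)).

(* Telescoping the gradient inequality along K equal steps from x to y replaces
   the integral of the gradient by a right Riemann sum. *)
Lemma gradient_descent_le_step (x d : 'rV[R]_p) (e : R) (k : nat) : 0 <= e ->
  h (x + (k%:R * e) *: d) <=
  h x + k%:R * e * dotv (g x) d + M * e ^+ 2 * (\sum_(i < k) i.+1%:R) * dotv d d.
Proof.
move=> e0; elim: k => [|k IH].
  by rewrite big_ord0 !mul0r scale0r addr0 mulr0 mul0r !addr0.
set z := x + (k.+1%:R * e) *: d.
have := convex_gradient_le z (x + (k%:R * e) *: d).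
have -> : x + (k%:R * e) *: d - z = - e *: d.
  by apply/rowP => i; rewrite !mxE -natr1; ring.
rewrite dotvZr.
have : dotv (g z - g x) d <= M * (k.+1%:R * e) * dotv d d.
  apply: le_trans (dotv_le_enorm _ _) _.
  rewrite -enorm_sqr expr2 mulrA ler_wpM2r ?enorm_ge0//.
  apply: le_trans (glip _ _) _.
  rewrite -mulrA ler_wpM2l ?(ltW M0)//.
  have -> : z - x = (k.+1%:R * e) *: d by rewrite /z addrC addKr.
  rewrite /enorm dotvZl dotvZr mulrA -expr2 sqrtrM ?sqr_ge0// sqrtr_sqr ger0_norm//.
  by rewrite mulr_ge0.
rewrite dotvDl dotvNl big_ord_recr/= => A B.
have := ler_wpM2l e0 A; move: IH B; rewrite -/z -natr1; nra.
Qed.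

Lemma gradient_descent_le (x y : 'rV[R]_p) :
  h y <= h x + dotv (g x) (y - x) + M / 2 * dotv (y - x) (y - x).
Proof.
set d := y - x.
apply/ler_addgt0Pr => e e0.
have Mdd : 0 <= M / 2 * dotv d d by rewrite mulr_ge0 ?dotvv_ge0// divr_ge0 ?ltW.
(* With [K] steps the Riemann sum exceeds the claimed quadratic term by exactly
   [M / 2 * dotv d d / K%:R]; this [K] makes the excess smaller than [e]. *)
have [K Kbig] : exists K : nat, M / 2 * dotv d d / e < K%:R.
  by exists (Num.truncn (M / 2 * dotv d d / e)).+1; rewrite truncnS_gt.
have K0 : 0 < K%:R :> R by apply: le_lt_trans Kbig; rewrite divr_ge0// ltW.
have := @gradient_descent_le_step x d K%:R^-1 K.
rewrite invr_ge0 ltW// => /(_ isT).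
rewrite divff ?gt_eqF// scale1r mul1r.
have -> : x + d = y by rewrite /d addrC subrK.
move=> H; apply: le_trans H _; rewrite -!addrA !lerD2l.
have -> : \sum_(i < K) i.+1%:R = K%:R * (K%:R + 1) / 2 :> R.
  elim: (K) => [|k IH]; first by rewrite big_ord0 !mul0r.
  by rewrite big_ord_recr/= IH -natr1; field.
have -> : M * K%:R^-1 ^+ 2 * (K%:R * (K%:R + 1) / 2) * dotv d d =
  M / 2 * dotv d d + M / 2 * dotv d d / K%:R by field; rewrite gt_eqF.
rewrite lerD2l ler_pdivrMr// [e * _]mulrC -ler_pdivrMr// (ltW Kbig)//.
Qed.

End SmoothConvex.

(** * Linear convergence of accelerated gradient descent *)

Section AGD.
Context {R : realType} {p : nat}.
Variables (F : 'rV[R]_p -> R) (G : 'rV[R]_p -> 'rV[R]_p) (mu L : R).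
Hypotheses (mu0 : 0 < mu) (L0 : 0 < L).
Hypothesis Fsc : forall x y,
  F y + dotv (G y) (x - y) + mu / 2 * dotv (x - y) (x - y) <= F x.
Hypothesis Fsmooth : forall x y,
  F x <= F y + dotv (G y) (x - y) + L / 2 * dotv (x - y) (x - y).
Variable xs : 'rV[R]_p.
Hypothesis Fmin : forall x, F xs <= F x.

Lemma gradient_step_le y : F (y - L^-1 *: G y) <= F y - L^-1 / 2 * dotv (G y) (G y).
Proof.
apply: le_trans (Fsmooth _ y) _.
rewrite [y - _]addrC addrK !dotvE le_eqVlt; apply/orP; left; apply/eqP.
by field; rewrite gt_eqF.
Qed.

(** A gradient step from [xs] lowers [F] by a positive multiple of the squared gradient norm, which
    minimality forces to be zero. *)
Lemma gradient_min_eq0 : G xs = 0.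
Proof.
apply: dotv0_eq0.
have := le_trans (Fmin _) (gradient_step_le xs).
have : 0 < L^-1 by rewrite invr_gt0.
by move=> ?; rewrite lerDl oppr_ge0 pmulr_rle0// divr_gt0.
Qed.

Lemma strongly_convex_growth x : mu / 2 * dotv (x - xs) (x - xs) <= F x - F xs.
Proof. by rewrite lerBrDl; have := Fsc x xs; rewrite gradient_min_eq0 dotv0l addr0. Qed.

Variable theta : R.
Hypotheses (theta0 : 0 < theta) (theta1 : theta < 1).
Hypothesis thetaE : theta ^+ 2 = mu / L.

(* [estimate x y] is the estimate-sequence point v with y = (x + theta v) / (1 + theta). *)
Let estimate (x y : 'rV[R]_p) := theta^-1 *: ((1 + theta) *: y - x).
Let lyapunov (s : 'rV[R]_p * 'rV[R]_p) :=
  F s.1 - F xs + mu / 2 * dotv (estimate s.1 s.2 - xs) (estimate s.1 s.2 - xs).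

Lemma agd_step_contract x y x' : x' = y - L^-1 *: G y ->
  lyapunov (x', x' + ((1 - theta) / (1 + theta)) *: (x' - x)) <=
  (1 - theta) * lyapunov (x, y).
Proof.
move=> x'E; rewrite /lyapunov /=.
set v := estimate x y; set v' := estimate x' _.
have t1 : 1 + theta != 0 by rewrite gt_eqF// addr_gt0.
have tn0 : theta != 0 by rewrite gt_eqF.
have Ln0 : L != 0 by rewrite gt_eqF.
set a := v - xs; pose b := y - xs.
have muE : mu = theta ^+ 2 * L by rewrite thetaE divfK.
(* The estimate point averages [v] and [y] with weights [1 - theta] and [theta], then takes a
   gradient step of length 1 / (theta L). *)
have vE : v' - xs = (1 - theta) *: a + theta *: b - (theta * L)^-1 *: G y.
  apply/rowP => i; rewrite /v' /a /b /v /estimate x'E !mxE.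
  by field; rewrite t1 tn0 Ln0.
have xE : x - y = theta *: b - theta *: a.
  by apply/rowP => i; rewrite /a /b /v /estimate !mxE; field.
have xsE : xs - y = - b by rewrite /b opprB.
clearbody a b.
(* Since mu = theta^2 L, the squared gradient gets the coefficient 1 / (2 L), exactly what the
   gradient step from [y] to [x'] gains. *)
have key : mu / 2 * dotv (v' - xs) (v' - xs) =
    mu / 2 * ((1 - theta) ^+ 2 * dotv a a + theta ^+ 2 * dotv b b
              + 2 * theta * (1 - theta) * dotv a b)
    + L^-1 / 2 * dotv (G y) (G y)
    - theta * ((1 - theta) * dotv (G y) a + theta * dotv (G y) b).
  rewrite vE !dotvE (dotvC b a) (dotvC a (G y)) (dotvC b (G y)) muE.
  by field; rewrite tn0 Ln0.
rewrite key.
(* Strong convexity at [y] is used towards [x] with weight [1 - theta] and towards [xs] with weight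
   [theta]. The linear terms then cancel those of [key], and the quadratic terms leave the
   nonnegative remainder [ab]. *)
have step := gradient_step_le y.
have ab : 0 <= mu / 2 * (theta * (1 - theta)) * dotv (a - b) (a - b).
  by rewrite !mulr_ge0 ?dotvv_ge0 ?invr_ge0 ?subr_ge0// ltW.
have Hx : 0 <= (1 - theta) * (F x - F y - dotv (G y) (x - y)).
  rewrite mulr_ge0 ?subr_ge0 ?(ltW theta1)// lerBrDl.
  apply: le_trans (Fsc x y); rewrite addrC lerDl mulr_ge0 ?dotvv_ge0//.
  by rewrite divr_ge0// ltW.
have Hs : 0 <= theta * (F xs - (F y + dotv (G y) (xs - y)
                      + mu / 2 * dotv (xs - y) (xs - y))).
  by rewrite mulr_ge0 ?subr_ge0 ?(ltW theta0).
move: ab Hx Hs; rewrite xE xsE !dotvE (dotvC b a).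
move: step; rewrite -x'E; nra.
Qed.

Lemma agd_contract x0 k :
  F (agd G L^-1 ((1 - theta) / (1 + theta)) x0 k).1 - F xs <=
  2 * (1 - theta) ^+ k * (F x0 - F xs).
Proof.
set beta := (1 - theta) / (1 + theta).
have sqge v : 0 <= mu / 2 * dotv v v by rewrite mulr_ge0 ?dotvv_ge0// divr_ge0// ltW.
apply: (@le_trans _ _ (lyapunov (agd G L^-1 beta x0 k))); first by rewrite lerDl.
have -> : 2 * (1 - theta) ^+ k * (F x0 - F xs) =
  (1 - theta) ^+ k * (2 * (F x0 - F xs)) by ring.
elim: k => [|k IH].
  (* Both sequences start at [x0], so the estimate point is [x0] too; quadratic growth then bounds
     the distance term by the suboptimality, whence the factor 2. *)
  rewrite mul1r /lyapunov /=.
  have -> : estimate x0 x0 = x0.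
    by apply/rowP => i; rewrite !mxE; field; rewrite gt_eqF.
  have := strongly_convex_growth x0; lra.
rewrite exprS -mulrA; case E : (agd _ _ _ _ k) IH => [x y] IH.
rewrite /= E; apply: le_trans (@agd_step_contract x y _ erefl) _.
by rewrite ler_wpM2l// subr_ge0 ltW.
Qed.

End AGD.

(** * Integral inequalities with limited measurability *)

Section LowerIntegral.
Context {d} {T : measurableType d} {R : realType}.
Variable mu : {measure set T -> \bar R}.
Local Open Scope ereal_scope.
Import HBNNSimple.

(* The integral of a nonnegative function is a supremum over simple functions,
   i.e. a lower integral, hence monotone even without measurability. *)
Lemma ge0_le_lower_integral (f1 f2 : T -> \bar R) :
  (forall x, 0 <= f1 x) -> (forall x, f1 x <= f2 x) ->
  \int[mu]_x f1 x <= \int[mu]_x f2 x.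
Proof.
move=> f10 f12.
have f20 x : 0 <= f2 x by exact: le_trans (f10 x) (f12 x).
rewrite !ge0_integralTE//; apply: ereal_sup_le => _ [h/= hf <-].
by exists h => // x; exact: le_trans (hf x) (f12 x).
Qed.

(* Lower integrals are subadditive as soon as one summand is measurable: for a
   simple h <= q (A + B), the measurable function (h / q - B)^+ lies below A. *)
Lemma le_lower_integralD (q : R) (F A B : T -> \bar R) : (0 < q)%R ->
  (forall x, 0 <= F x) -> (forall x, 0 <= A x) ->
  (forall x, 0 <= B x) -> measurable_fun setT B ->
  (forall x, F x <= q%:E * (A x + B x)) ->
  \int[mu]_x F x <= q%:E * (\int[mu]_x A x + \int[mu]_x B x).
Proof.
move=> q0 F0 A0 B0 mB FAB.
rewrite [leLHS]ge0_integralTE//; apply: ge_ereal_sup => _ [h/= hF <-].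
pose m x := maxe 0 ((q^-1 * h x)%:E - B x).
have m0 x : 0 <= m x by rewrite le_max lexx.
have mm : measurable_fun setT m.
  apply: measurable_maxe => //; apply: emeasurable_funB => //.
  by apply/measurable_EFinP; apply: measurable_funM.
have mA x : m x <= A x.
  rewrite ge_max A0/=; have := le_trans (hF x) (FAB x).
  case: (B x) (B0 x) => [b| |]//= _; last by rewrite addeNy ?leNye.
  case: (A x) (A0 x) => [a| |]//= _; last by rewrite leey.
  rewrite -EFinD -EFinM lee_fin -EFinB lee_fin => H.
  by rewrite lerBlDr mulrC ler_pdivrMr// mulrC.
have hm x : (h x)%:E <= q%:E * (m x + B x).
  rewrite /m; case: (B x) (B0 x) => [b| |]//= _; last first.
    by rewrite addeNy maxeNy add0e gt0_muley ?lte_fin// leey.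
  rewrite -EFinB -EFin_max -EFinD -EFinM lee_fin -ler_pdivrMl//.
  by rewrite -lerBlDr le_max lexx orbT.
rewrite -integralT_nnsfun.
apply: (@le_trans _ _ (\int[mu]_x (q%:E * (m x + B x)))).
  by apply: ge0_le_lower_integral => // x; rewrite lee_fin.
rewrite ge0_integralZl_EFin//; last 3 first.
- by move=> x _; rewrite adde_ge0.
- exact: emeasurable_funD.
- exact: ltW.
rewrite ge0_integralD//.
by rewrite lee_pmul2l// leeD2r// ge0_le_lower_integral.
Qed.

End LowerIntegral.

(** Indices outside the image of [e] receive the sure event, which changes neither the intersection
    nor the product of probabilities. *)
Lemma independent_rvs_inj (R : realType) dO dZ (Omega : measurableType dO)
  (Z : measurableType dZ) (Pr : probability Omega R) (I J : finType)
  (X : J -> Omega -> Z) (e : I -> J) : injective e ->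
  independent_rvs Pr X -> independent_rvs Pr (X \o e).
Proof.
move=> einj indX B mB.
pose B' j : set Z := if [pick i | e i == j] is Some i then B i else setT.
have B'e i : B' (e i) = B i.
  rewrite /B'; case: pickP => [i' /eqP/einj -> //|/(_ i)].
  by rewrite eqxx.
have B'T j : j \notin [set e i | i in [set: I]]%SET -> B' j = setT.
  move=> jn; rewrite /B'; case: pickP => // i' /eqP ej.
  by move: jn; rewrite -ej imset_f.
have mB' j : measurable (B' j).
  by rewrite /B'; case: pickP => // i _; exact: mB.
have -> : \bigcap_(i in [set: I]) ((X \o e) i @^-1` B i) =
          \bigcap_(j in [set: J]) (X j @^-1` B' j).
  apply/seteqP; split => om /= H j _; last by rewrite -B'e; exact: H.
  case: (boolP (j \in [set e i | i in [set: I]]%SET)) => [/imsetP[i _ ->]|/B'T ->//].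
  by rewrite /preimage /= B'e; exact: H.
rewrite indX// (bigID (mem [set e i | i in [set: I]]%SET))/= [X in (_ * X)%E]big1 ?mule1.
  rewrite big_imset/=; last by move=> i i' _ _ /einj.
  by rewrite big_set; apply: eq_bigr => i _; rewrite B'e.
by move=> j /B'T ->; rewrite preimage_setT probability_setT.
Qed.

(** * Local continuity estimates and approximation by rational vectors *)

Section CoordinateContinuity.
Context {R : realType} {p : nat}.
Implicit Types (h : 'rV[R]_p -> R) (w d : 'rV[R]_p).

(* By convexity the i-th summand dominates the i-th partial derivative of h at w;
   unlike the gradient it is visibly integrable when h depends on a sample. *)
Definition coord_var h w : R :=
  \sum_(i < p) (`|h (w + delta_mx ord0 i) - h w| + `|h (w - delta_mx ord0 i) - h w|).

Lemma dotv_delta w (i : 'I_p) : dotv w (delta_mx ord0 i) = w ord0 i.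
Proof.
rewrite /dotv (bigD1 i)//= big1 => [|j ji].
  by rewrite mxE !eqxx mulr1 addr0.
by rewrite mxE (negPf ji) andbF mulr0.
Qed.

(** Convexity towards the two points [w] plus or minus a unit vector bounds each partial derivative.
    The gradient inequality and the descent inequality then enclose the increment of [h]. *)
Lemma smooth_convex_coord_continuity h (g : 'rV[R]_p -> 'rV[R]_p) (M : R) w w' (e : R) :
  convex_fun h -> is_gradient h g -> 0 < M ->
  (forall w v, enorm (g w - g v) <= M * enorm (w - v)) ->
  0 <= e <= 1 -> (forall i, `|w' ord0 i - w ord0 i| <= e) ->
  `|h w' - h w| <= e * (coord_var h w + M / 2 * p%:R).
Proof.
move=> hc hg M0 hl /andP[e0 e1] we.
have gi i : `|g w ord0 i| <=
    `|h (w + delta_mx ord0 i) - h w| + `|h (w - delta_mx ord0 i) - h w|.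
  have := convex_gradient_le hc hg w (w + delta_mx ord0 i).
  have := convex_gradient_le hc hg w (w - delta_mx ord0 i).
  rewrite ![w + _ - w]addrC !addKr dotvNr dotv_delta => A B.
  have := ler_norm (h (w + delta_mx ord0 i) - h w).
  have := ler_norm (h (w - delta_mx ord0 i) - h w).
  have := normr_ge0 (h (w + delta_mx ord0 i) - h w).
  have := normr_ge0 (h (w - delta_mx ord0 i) - h w).
  by rewrite ler_norml => *; apply/andP; split; lra.
have gd : `|dotv (g w) (w' - w)| <= e * coord_var h w.
  apply: le_trans (ler_norm_sum _ _ _) _.
  rewrite mulr_sumr; apply: ler_sum => i _.
  by rewrite normrM mulrC !mxE ler_pM.
(* One factor of each square is bounded by 1 instead of [e], so that the whole estimate stays linear
   in [e]. *)
have dd : dotv (w' - w) (w' - w) <= e * p%:R.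
  have -> : e * p%:R = \sum_(i < p) e by rewrite sumr_const card_ord mulr_natr.
  apply: ler_sum => i _.
  apply: le_trans (ler_norm _) _; rewrite !mxE normrM -[leRHS]mulr1.
  by rewrite ler_pM// (le_trans (we i)).
have A := convex_gradient_le hc hg w w'.
have B := gradient_descent_le hc hg M0 hl w w'.
have C : M / 2 * dotv (w' - w) (w' - w) <= e * (M / 2 * p%:R).
  by rewrite mulrCA ler_pM2l// divr_gt0.
have C0 : 0 <= e * (M / 2 * p%:R) by rewrite !mulr_ge0// ?invr_ge0 ltW.
have D : 0 <= e * coord_var h w by apply: le_trans gd.
move: gd; rewrite !ler_norml mulrDr => /andP[? ?]; apply/andP; split; lra.
Qed.

(** An enumeration of the rational vectors; a number that encodes no vector gives 0. *)
Definition ratr_vec (n : nat) : 'rV[R]_p := map_mx ratr (odflt 0 (unpickle n : option 'rV[rat]_p)).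

Lemma ratr_vec_dense w (e : R) : 0 < e ->
  exists n, forall i, `|ratr_vec n ord0 i - w ord0 i| <= e.
Proof.
move=> e0.
have H i : exists q : rat, `|ratr q - w ord0 i| <= e.
  have [q] := @rat_in_itvoo R (w ord0 i - e) (w ord0 i + e) ltac:(lra).
  rewrite in_itv/= => /andP[? ?]; exists q.
  by rewrite ler_norml; apply/andP; split; lra.
pose q : 'rV[rat]_p := \row_i projT1 (cid (H i)).
exists (pickle q) => i; rewrite /ratr_vec pickleK/= !mxE.
exact: projT2 (cid (H i)).
Qed.

Lemma le_esups_ratr_vec h w (K : R) : 0 <= K ->
  (forall w' e, 0 <= e <= 1 -> (forall i, `|w' ord0 i - w ord0 i| <= e) ->
    h w <= h w' + e * K) ->
  ((h w)%:E <= esups (fun n => (h (ratr_vec n))%:E) 0%N)%E.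
Proof.
move=> K0 hK; apply/lee_addgt0Pr => e e0.
(* The cap at 1 meets the range required by [hK]; the [+ 1] keeps the denominator positive when [K]
   is 0. *)
pose d := Num.min 1 (e / (K + 1)).
have K1 : 0 < K + 1 by rewrite ltr_wpDl.
have d0 : 0 < d by rewrite lt_min ltr01 divr_gt0.
have [n hn] := ratr_vec_dense w d0.
have := hK _ _ _ hn; rewrite (ltW d0) ge_min lexx => /(_ isT) hw.
apply: (@le_trans _ _ ((h (ratr_vec n))%:E + e%:E)%E).
  rewrite -EFinD lee_fin (le_trans hw)// lerD2l.
  apply: (@le_trans _ _ (e / (K + 1) * K)).
    by rewrite ler_wpM2r// ge_min lexx orbT.
  rewrite mulrAC ler_pdivrMr// ler_pM2l//; lra.
by rewrite leeD2r//; apply: ereal_sup_ubound; exists n.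
Qed.

End CoordinateContinuity.

(** * Measurable uniform deviations and their expectation *)

Section UniformDeviation.
Context {R : realType} {p : nat} {dZ dO : measure_display}.
Context {Z : measurableType dZ} {Omega : measurableType dO}.
Variables (P : probability Z R) (Pr : probability Omega R).
Variables (f : 'rV[R]_p -> Z -> R) (g : 'rV[R]_p -> Z -> 'rV[R]_p) (M : R).
Hypothesis M0 : 0 < M.
Hypothesis fmeas : forall w, measurable_fun setT (f w).
Hypothesis fint : forall w, P.-integrable setT (fun x => (f w x)%:E).
Hypothesis fconv : forall x, convex_fun (fun w => f w x).
Hypothesis fgrad : forall x, is_gradient (fun w => f w x) (fun w => g w x).
Hypothesis glip : forall x w v, enorm (g w x - g v x) <= M * enorm (w - v).

Lemma Lexp_coord_continuity (w : 'rV[R]_p) : exists2 K, 0 <= K &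
  forall (w' : 'rV[R]_p) (e : R), 0 <= e <= 1 -> (forall i, `|w' ord0 i - w ord0 i| <= e) ->
    `|Lexp P f w' - Lexp P f w| <= e * K.
Proof.
pose k x := coord_var (f^~ x) w + M / 2 * p%:R.
have kint : P.-integrable setT (EFin \o k).
  apply: (@eq_integrable _ _ _ _ _ measurableT (fun x =>
    (\sum_(i < p) (`|(f (w + delta_mx ord0 i) x)%:E - (f w x)%:E|
                + `|(f (w - delta_mx ord0 i) x)%:E - (f w x)%:E|)
     + (M / 2 * p%:R)%:E)%E)).
    by move=> x _; rewrite /k /coord_var /= EFinD -sumEFin.
  apply: integrableD => //; last exact: finite_measure_integrable_cst.
  apply: integrable_sum => // i _; apply: integrableD => //;
    by apply/integrable_abse/integrableB.
exists (Rintegral P setT k).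
  apply: Rintegral_ge0 => x _; rewrite addr_ge0//; last by rewrite !mulr_ge0// ?invr_ge0 ltW.
  by apply: sumr_ge0 => i _; rewrite addr_ge0.
move=> w' e e01 we.
have dint : P.-integrable setT (EFin \o (fun x => f w' x - f w x)).
  by apply: (integrableB measurableT (fint w') (fint w)).
rewrite -[Lexp P f w']/(Rintegral P setT (f w')) -[Lexp P f w]/(Rintegral P setT (f w)).
rewrite -RintegralB//.
rewrite -(RintegralZl e measurableT kint).
apply: le_trans (le_normr_Rintegral _ _) _ => //.
apply: le_Rintegral => //; last first.
- by move=> x _; apply: smooth_convex_coord_continuity.
- exact: (integrableZl measurableT e kint).
- exact: (integrable_abse dint).
- exact: fint.
- exact: fint.
Qed.

Variables (gamma alpha : R) (N : nat) (z : 'I_N -> Omega -> Z).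
Hypothesis zmeas : forall i, measurable_fun setT (z i).
Hypothesis zind : independent_rvs Pr z.
Hypothesis zlaw : forall i, has_law Pr (z i) P.
Hypothesis accuracy : forall (k : nat) (y : 'I_k -> Omega -> Z), (0 < k)%N ->
  (forall i, measurable_fun setT (y i)) ->
  independent_rvs Pr y -> (forall i, has_law Pr (y i) P) ->
  (\int[Pr]_om
     ereal_sup [set (`| Lexp P f w - (k%:R)^-1 * \sum_(i < k) f w (y i om) |)%:E
               | w in [set: 'rV[R]_p]]
   <= (Vacc gamma alpha k)%:E)%E.

Definition deviation (S : {set 'I_N}) om w : R := `|Lexp P f w - Lemp f z S om w|.

(* Only rational points enter the supremum, which makes it measurable; continuity
   of the deviation extends the bound to all points. *)
Definition sup_deviation S om : \bar R :=
  esups (fun n => (deviation S om (ratr_vec n))%:E) 0%N.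

Lemma sup_deviation_ge0 S om : (0 <= sup_deviation S om)%E.
Proof.
apply: (@le_trans _ _ (deviation S om (ratr_vec 0))%:E); first by rewrite lee_fin normr_ge0.
by apply: ereal_sup_ubound; exists 0%N.
Qed.

Lemma Lemp_coord_continuity S om (w : 'rV[R]_p) : exists2 K, 0 <= K &
  forall (w' : 'rV[R]_p) (e : R), 0 <= e <= 1 -> (forall i, `|w' ord0 i - w ord0 i| <= e) ->
    `|Lemp f z S om w' - Lemp f z S om w| <= e * K.
Proof.
have C0 x : 0 <= coord_var (f^~ x) w + M / 2 * p%:R.
  rewrite addr_ge0//; last by rewrite !mulr_ge0// ?invr_ge0 ltW.
  by apply: sumr_ge0 => i _; rewrite addr_ge0.
exists (#|S|%:R^-1 * \sum_(i in S) (coord_var (f^~ (z i om)) w + M / 2 * p%:R)).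
  by rewrite mulr_ge0 ?invr_ge0// sumr_ge0.
move=> w' e e01 we.
rewrite /Lemp -mulrBr normrM ger0_norm ?invr_ge0// mulrCA ler_wpM2l ?invr_ge0//.
rewrite -sumrB mulr_sumr; apply: le_trans (ler_norm_sum _ _ _) _.
by apply: ler_sum => i _; apply: smooth_convex_coord_continuity.
Qed.

Lemma le_sup_deviation S om w : ((deviation S om w)%:E <= sup_deviation S om)%E.
Proof.
have [K1 K10 H1] := Lexp_coord_continuity w.
have [K2 K20 H2] := Lemp_coord_continuity S om w.
apply: (@le_esups_ratr_vec _ _ _ _ (K1 + K2)); first exact: addr_ge0.
move=> w' e e01 we; have := H1 _ _ e01 we; have := H2 _ _ e01 we.
rewrite /deviation mulrDr => A B.
have -> : Lexp P f w - Lemp f z S om w = (Lexp P f w' - Lemp f z S om w')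
  + ((Lemp f z S om w' - Lemp f z S om w) - (Lexp P f w' - Lexp P f w)) by ring.
apply: le_trans (ler_normD _ _) _; rewrite lerD2l.
by apply: le_trans (ler_normB _ _) _; rewrite addrC lerD.
Qed.

Lemma measurable_sup_deviation S : measurable_fun setT (sup_deviation S).
Proof.
apply: measurable_fun_esups => n; apply/measurable_EFinP.
apply: measurableT_comp => //; apply: measurable_funB => //.
apply: measurable_funM => //; under eq_fun do rewrite -big_enum/=.
apply: measurable_sum => i.
exact: measurableT_comp (zmeas i).
Qed.

(** Enumerating [S] gives [#|S|] independent samples, to which [accuracy] applies. The supremum over
    rational points lies below the full one, and lower integrals compare the two without
    measurability of the latter. *)
Lemma integral_sup_deviation_le (S : {set 'I_N}) : (0 < #|S|)%N ->
  (\int[Pr]_om sup_deviation S om <= (Vacc gamma alpha #|S|)%:E)%E.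
Proof.
move=> S0; pose y (i : 'I_#|S|) := z (enum_val i).
have := @accuracy _ y S0 (fun i => zmeas _)
  (independent_rvs_inj (@enum_val_inj _ _) zind) (fun i => zlaw _).
apply: le_trans; apply: ge0_le_lower_integral => om; first exact: sup_deviation_ge0.
apply: ge_ereal_sup => _ [n _ <-]; apply: ereal_sup_ubound; exists (ratr_vec n) => //.
by rewrite /deviation /Lemp [in RHS]big_enum_val.
Qed.

End UniformDeviation.

(** * The regularized risk: curvature, contraction, and doubling of the sample *)

Section RegularizedRisk.
Context {R : realType} {p : nat} {dZ dO : measure_display}.
Context {Z : measurableType dZ} {Omega : measurableType dO}.
Variables (f : 'rV[R]_p -> Z -> R) (g : 'rV[R]_p -> Z -> 'rV[R]_p).
Variables (M gamma alpha c : R) (N : nat) (z : 'I_N -> Omega -> Z).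
Hypotheses (M0 : 0 < M) (gamma0 : 0 < gamma) (c0 : 0 < c).
Hypothesis fconv : forall x, convex_fun (fun w => f w x).
Hypothesis fgrad : forall x, is_gradient (fun w => f w x) (fun w => g w x).
Hypothesis glip : forall x w v, enorm (g w x - g v x) <= M * enorm (w - v).

Let V := Vacc gamma alpha.

Lemma Vacc_gt0 n : (0 < n)%N -> 0 < V n.
Proof. by move=> n0; rewrite divr_gt0// powR_gt0// ltr0n. Qed.

Lemma Vacc_half m : (0 < m)%N -> V m = 2 `^ alpha * V (2 * m).
Proof.
move=> m0; rewrite /V /Vacc natrM powRM//; field.
by rewrite !gt_eqF// powR_gt0// ltr0n.
Qed.

Section Fixed.
Variables (S : {set 'I_N}) (om : Omega).
Hypothesis S0 : (0 < #|S|)%N.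
Let k0 : 0 < #|S|%:R :> R. Proof. by rewrite ltr0n. Qed.
Let lam := c * V #|S|.
Let lam0 : 0 < lam. Proof. by rewrite mulr_gt0// Vacc_gt0. Qed.
Let F := Rreg gamma alpha c f z S om.
Let G := gradRreg gamma alpha c g z S om.

(** The gradient inequalities of the losses are averaged; the squared norm expands exactly around
    [y], and its second-order term supplies the modulus [lam]. *)
Lemma Rreg_strongly_convex x y :
  F y + dotv (G y) (x - y) + lam / 2 * dotv (x - y) (x - y) <= F x.
Proof.
have : \sum_(i in S) (f y (z i om) + dotv (g y (z i om)) (x - y)) <=
       \sum_(i in S) f x (z i om).
  by apply: ler_sum => i _; exact: (convex_gradient_le (fconv _) (fgrad _)).
rewrite big_split/= -dotv_suml -(ler_pM2l (x := #|S|%:R^-1)) ?invr_gt0// mulrDr.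
rewrite /F /G /Rreg /gradRreg /Lemp -/V -/lam !enorm_sqr dotvDl !dotvZl => H.
have xx : dotv x x = dotv y y + 2 * dotv y (x - y) + dotv (x - y) (x - y).
  by rewrite !dotvE (dotvC y x); ring.
by rewrite xx; lra.
Qed.

Lemma Rreg_smooth x y :
  F x <= F y + dotv (G y) (x - y) + (lam + M) / 2 * dotv (x - y) (x - y).
Proof.
have : \sum_(i in S) f x (z i om) <=
  \sum_(i in S) (f y (z i om) + dotv (g y (z i om)) (x - y)
                 + M / 2 * dotv (x - y) (x - y)).
  by apply: ler_sum => i _; exact: (gradient_descent_le (fconv _) (fgrad _)).
rewrite !big_split/= -dotv_suml sumr_const -(ler_pM2l (x := #|S|%:R^-1)) ?invr_gt0//.
rewrite !mulrDr -[(M / 2 * _) *+ _]mulr_natl mulKf ?gt_eqF// => H.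
rewrite /F /G /Rreg /gradRreg /Lemp -/V -/lam !enorm_sqr (dotvDl (_ *: _)) !dotvZl.
have xx : dotv x x = dotv y y + 2 * dotv y (x - y) + dotv (x - y) (x - y).
  by rewrite !dotvE (dotvC y x); ring.
by rewrite xx; lra.
Qed.

Let theta := Num.sqrt lam / Num.sqrt (lam + M).

Lemma agd_Rreg_le s w0 ws : (forall w, F ws <= F w) ->
  F (agd G (eta_n gamma alpha c M #|S|) (beta_n gamma alpha c M #|S|) w0 s).1 - F ws
  <= 2 * (1 - theta) ^+ s * (F w0 - F ws).
Proof.
move=> Fmin.
have L0 : 0 < lam + M by rewrite addr_gt0.
have sL : 0 < Num.sqrt (lam + M) by rewrite sqrtr_gt0.
have sl : 0 < Num.sqrt lam by rewrite sqrtr_gt0.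
(* Dividing numerator and denominator by [Num.sqrt (lam + M)] gives the momentum in terms of
   [theta]. *)
have -> : beta_n gamma alpha c M #|S| = (1 - theta) / (1 + theta).
  rewrite /beta_n -/V -/lam /theta; field.
  by rewrite !gt_eqF// addr_gt0.
apply: (@agd_contract _ _ F G lam) => //.
- exact: Rreg_strongly_convex.
- exact: Rreg_smooth.
- by rewrite divr_gt0.
- by rewrite ltr_pdivrMr// mul1r ltr_sqrt// ltrDl.
- by rewrite expr_div_n !sqr_sqrtr// ltW.
Qed.

(** The square root in [sbound] is 1 / theta, so the bound on [s] says that s theta is at least ln
    C; then 1 - theta <= exp(-theta) gives the claim. *)
Lemma sbound_contract s (wstar : 'rV[R]_p) :
  let C := 6 * 2 `^ alpha + (2 `^ alpha - 1) * (4 + c * enorm wstar ^+ 2) in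
  0 < C -> sbound gamma alpha c M wstar #|S| <= s%:R ->
  0 < (1 - theta) ^+ s /\ (1 - theta) ^+ s * C <= 1.
Proof.
move=> C C0 hs.
have L0 : 0 < lam + M by rewrite addr_gt0.
have sL : 0 < Num.sqrt (lam + M) by rewrite sqrtr_gt0.
have sl : 0 < Num.sqrt lam by rewrite sqrtr_gt0.
have t0 : 0 < theta by rewrite divr_gt0.
have t1 : theta < 1 by rewrite ltr_pdivrMr// mul1r ltr_sqrt// ltrDl.
split; first by rewrite exprn_gt0// subr_gt0.
have kE : Num.sqrt ((#|S|%:R `^ alpha * M + c * gamma) / (c * gamma)) = theta^-1.
  rewrite /theta invf_div -sqrtrV ?(ltW lam0)// -sqrtrM ?(ltW L0)//.
  congr Num.sqrt; rewrite /lam /V /Vacc; field.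
  by rewrite !gt_eqF// powR_gt0.
move: hs; rewrite /sbound kE /logfac -/C ler_pdivrMl// => hs.
apply: (@le_trans _ _ (expR (- theta) ^+ s * C)).
  rewrite ler_wpM2r ?(ltW C0)// lerXn2r ?nnegrE ?subr_ge0 ?(ltW t1) ?expR_ge0//.
  exact: expR_ge1Dx.
rewrite -expRM_natl mulrN expRN mulrC ler_pdivrMr ?expR_gt0// mul1r.
by rewrite -[leLHS]lnK// ler_expR mulrC.
Qed.

End Fixed.


Lemma Lemp_half (Sm Sn : {set 'I_N}) om w : (0 < #|Sm|)%N -> Sm \subset Sn ->
  #|Sn| = (2 * #|Sm|)%N ->
  Lemp f z Sn om w = (Lemp f z (Sn :\: Sm) om w + Lemp f z Sm om w) / 2.
Proof.
move=> m0 sub nE.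
have dE : #|Sn :\: Sm| = #|Sm|.
  by rewrite cardsD (finset.setIidPr sub) nE mul2n -addnn addnK.
rewrite /Lemp dE nE (big_setID Sm)/= (finset.setIidPr sub) natrM; field.
by rewrite pnatr_eq0 -lt0n.
Qed.

Variables (P : probability Z R) (wstar : 'rV[R]_p).
Hypothesis wstar_min : forall w, Lexp P f wstar <= Lexp P f w.

Lemma suboptimality_transfer (Sm Sn : {set 'I_N}) om (w wm wn : 'rV[R]_p) (D Dm Dn r : R) :
  let dev := deviation P f z in
  let Rm := Rreg gamma alpha c f z Sm om in let Rn := Rreg gamma alpha c f z Sn om in
  (0 < #|Sm|)%N -> Sm \subset Sn -> #|Sn| = (2 * #|Sm|)%N ->
  (forall v, dev (Sn :\: Sm) om v <= D) ->
  (forall v, dev Sm om v <= Dm) -> (forall v, dev Sn om v <= Dn) ->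
  0 <= r -> V #|Sm| = (1 + r) * V #|Sn| ->
  (forall v, Rm wm <= Rm v) -> (forall v, Rn wn <= Rn v) ->
  Rn w - Rn wn <= (Rm w - Rm wm) +
    (D + Dm + (r * V #|Sn| * (c / 2 * enorm wstar ^+ 2) + 2 * r * Dn)).
Proof.
move=> dev Rm Rn m0 sub nE hD hDm hDn r0 VmE hwm hwn.
have vn0 : 0 < V #|Sn| by rewrite Vacc_gt0// nE muln_gt0.
move: (hD w) (hD wn) (hDm w) (hDm wn) (hDn wstar) (hDn wn).
rewrite /dev /deviation !ler_norml => /andP[? ?] /andP[? ?] /andP[? ?] /andP[? ?]
  /andP[? ?] /andP[? ?].
have wx := wstar_min wn.
have := hwn wstar; have := hwm wn.
rewrite /Rm /Rn /Rreg -/V VmE.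
have := Lemp_half om w m0 sub nE; have := Lemp_half om wn m0 sub nE.
set x := enorm wn ^+ 2; set y := enorm w ^+ 2; set W := enorm wstar ^+ 2.
move=> e1 e2 H1 H2.
(* The stronger penalty in [Rm] leaves this term at [w], which may be dropped thanks to its sign. *)
have y0 : 0 <= r * (c * V #|Sn| / 2 * y).
  by rewrite !mulr_ge0 ?sqr_ge0 ?invr_ge0 ?enorm_ge0// ltW.
(* Compare [Rn] at [wn] and [wstar]: passing from the empirical loss to [Lexp] costs [Dn] at each
   point, and [wstar] minimizes [Lexp]. *)
have xW : c * V #|Sn| / 2 * x <= c * V #|Sn| / 2 * W + 2 * Dn by lra.
have rx := ler_wpM2l r0 xW.
lra.
Qed.

End RegularizedRisk.

(** * Total cost over doubling sample sizes *)

Lemma powR2_gt1 (R : realType) (alpha : R) : 0 < alpha -> 1 < 2 `^ alpha.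
Proof.
move=> alpha0; have := gt0_ltr_powR alpha0 (x := 1) (y := 2); rewrite powR1.
by apply; rewrite ?nnegrE// ltr1n.
Qed.

(** Since sqrt(a + 1) <= 1 + sqrt(a), the sum splits into [q.+1] terms of size at most N, and a sum
    whose terms grow by the factor 2 [rho], bounded through its last term. *)
Lemma sum_gradient_evaluations (R : realType) (p : nat) (gamma alpha c M : R) (N q m0 : nat)
  (wstar : 'rV[R]_p) :
  0 < gamma -> 1/2 <= alpha <= 1 -> 0 < c -> 0 < M ->
  (0 < m0)%N -> N = (2 ^ q * m0)%N ->
  \sum_(j < q.+1) (m0 * 2 ^ j)%:R * sbound gamma alpha c M wstar (m0 * 2 ^ j)
  <= N%:R * (1 + ln (N%:R / m0%:R) / ln 2
             + Num.sqrt (2 `^ alpha) / (Num.sqrt (2 `^ alpha) - 1)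
               * Num.sqrt (N%:R `^ alpha * M / (c * gamma)))
         * logfac alpha c wstar.
Proof.
move=> gamma0 /andP[a0 a1] c0 M0 m0_gt0 NE.
have alpha0 : 0 < alpha by lra.
have twoa := powR2_gt1 alpha0.
have lf0 : 0 <= logfac alpha c wstar.
  apply: ln_ge0; have : 0 <= (2 `^ alpha - 1) * (4 + c * enorm wstar ^+ 2).
    by rewrite mulr_ge0 ?subr_ge0 ?(ltW twoa)// addr_ge0// mulr_ge0 ?sqr_ge0 ?(ltW c0).
  by move: twoa; lra.
rewrite /sbound; under eq_bigr do rewrite mulrA; rewrite -mulr_suml ler_wpM2r//.
set rho := Num.sqrt (2 `^ alpha).
have rho1 : 1 < rho by rewrite -sqrtr1 ltr_sqrt// (lt_trans ltr01).
pose A n := Num.sqrt (n%:R `^ alpha * M / (c * gamma)) : R.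
have A0 n : 0 <= A n by exact: sqrtr_ge0.
have A2 n : A (2 * n)%N = rho * A n.
  rewrite /A natrM powRM// -!mulrA sqrtrM ?powR_ge0//.
have Ale n : Num.sqrt ((n%:R `^ alpha * M + c * gamma) / (c * gamma)) <= 1 + A n.
  have cg : 0 < c * gamma by rewrite mulr_gt0.
  have X0 : 0 <= n%:R `^ alpha * M / (c * gamma).
    by rewrite divr_ge0 ?mulr_ge0 ?powR_ge0// ltW.
  rewrite mulrDl divff ?gt_eqF// -[leRHS]ger0_norm ?addr_ge0// -sqrtr_sqr.
  rewrite ler_wsqrtr// sqrrD sqr_sqrtr// expr1n mul1r.
  by have := A0 n; lra.
have lnE : ln (N%:R / m0%:R) / ln 2 = q%:R :> R.
  rewrite NE natrM mulfK ?pnatr_eq0 -?lt0n// natrX lnXn// -[ln 2 *+ _]mulr_natl mulfK//.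
  by rewrite gt_eqF// ln_gt0// ltr1n.
rewrite lnE; apply: (@le_trans _ _ (\sum_(j < q.+1) (m0 * 2 ^ j)%:R * (1 + A (m0 * 2 ^ j)%N))).
  by apply: ler_sum => j _; rewrite ler_wpM2l.
under eq_bigr do rewrite mulrDr mulr1; rewrite big_split/=.
have -> : N%:R * (1 + q%:R + rho / (rho - 1) * A N) =
  N%:R * q.+1%:R + N%:R * A N * (rho / (rho - 1)) by rewrite -natr1; ring.
rewrite NE mulnC; apply: lerD.
  apply: (@le_trans _ _ (\sum_(j < q.+1) (m0 * 2 ^ q)%:R)).
    by apply: ler_sum => j _; rewrite ler_nat leq_mul2l leq_exp2l// -ltnS ltn_ord orbT.
  by rewrite sumr_const card_ord mulr_natr.
elim: (q) => [|k IH].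
  rewrite big_ord1 expn0 muln1 ler_peMr ?mulr_ge0// ler_pdivlMr ?subr_gt0// mul1r; lra.
rewrite big_ord_recr/=; apply: le_trans (lerD IH (lexx _)) _.
rewrite expnS mulnCA A2 (natrM _ 2).
set X := (m0 * 2 ^ k)%:R; set Y := A _.
have XY0 : 0 <= X * Y by rewrite mulr_ge0// A0.
(* The induction closes with a slack equal to the bound already obtained for [k]. *)
rewrite -subr_ge0.
have -> : 2 * X * (rho * Y) * (rho / (rho - 1)) -
    (X * Y * (rho / (rho - 1)) + 2 * X * (rho * Y)) = X * Y * (rho / (rho - 1)).
  by field; rewrite subr_eq0 gt_eqF.
by rewrite mulr_ge0// divr_ge0; lra.
Qed.

(** * Assembly of the one-stage expectation bound and the total cost *)

Unset Implicit Arguments.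
Theorem theorem3 (R : realType) (p : nat)
  (dZ : measure_display) (Z : measurableType dZ) (P : probability Z R)
  (dO : measure_display) (Omega : measurableType dO) (Pr : probability Omega R)
  (f : 'rV[R]_p -> Z -> R) (g : 'rV[R]_p -> Z -> 'rV[R]_p)
  (gamma alpha c M : R) (N : nat) (z : 'I_N -> Omega -> Z) (wstar : 'rV[R]_p) :
  (* constants *)
  0 < gamma -> 1/2 <= alpha <= 1 -> 0 < c -> 0 < M ->
  (* loss: measurable and integrable in z, so that L is defined *)
  (forall w, measurable_fun setT (f w)) ->
  (forall w, P.-integrable setT (fun x => (f w x)%:E)) ->
  (* f(., z) convex with M-Lipschitz gradient g(., z) *)
  (forall x, convex_fun (fun w => f w x)) ->
  (forall x, is_gradient (fun w => f w x) (fun w => g w x)) ->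
  (forall x w v, enorm (g w x - g v x) <= M * enorm (w - v)) ->
  (* w* minimizes L *)
  (forall w, Lexp P f wstar <= Lexp P f w) ->
  (* training set: N independent samples from P *)
  (forall i, measurable_fun setT (z i)) ->
  independent_rvs Pr z -> (forall i, has_law Pr (z i) P) ->
  (* statistical accuracy: for every k and every k independent samples from P *)
  (forall (k : nat) (y : 'I_k -> Omega -> Z), (0 < k)%N ->
     (forall i, measurable_fun setT (y i)) ->
     independent_rvs Pr y -> (forall i, has_law Pr (y i) P) ->
     (\int[Pr]_om
        ereal_sup [set (`| Lexp P f w - (k%:R)^-1 * \sum_(i < k) f w (y i om) |)%:E
                  | w in [set: 'rV[R]_p]]
      <= (Vacc gamma alpha k)%:E)%E) ->
  (* (i) *)
  (forall (m : nat) (Sm Sn : {set 'I_N}) (wm wm_star wn_star : Omega -> 'rV[R]_p) (sn : nat),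
     (1 <= m)%N -> #|Sm| = m -> #|Sn| = (2 * m)%N -> Sm \subset Sn ->
     (forall om w, Rreg gamma alpha c f z Sm om (wm_star om)
                   <= Rreg gamma alpha c f z Sm om w) ->
     (forall om w, Rreg gamma alpha c f z Sn om (wn_star om)
                   <= Rreg gamma alpha c f z Sn om w) ->
     (forall i j, measurable_fun setT (fun om => wm om i j)) ->
     (\int[Pr]_om (Rreg gamma alpha c f z Sm om (wm om)
                   - Rreg gamma alpha c f z Sm om (wm_star om))%:E
        <= (Vacc gamma alpha m)%:E)%E ->
     sbound gamma alpha c M wstar (2 * m) <= sn%:R ->
     (\int[Pr]_om
        (let wn := (agd (gradRreg gamma alpha c g z Sn om)
                        (eta_n gamma alpha c M (2 * m)) (beta_n gamma alpha c M (2 * m))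
                        (wm om) sn).1 in
         Rreg gamma alpha c f z Sn om wn - Rreg gamma alpha c f z Sn om (wn_star om))%:E
      <= (Vacc gamma alpha (2 * m))%:E)%E)
  /\
  (* (ii) *)
  (forall (q m0 : nat), (0 < m0)%N -> N = (2 ^ q * m0)%N ->
     \sum_(j < q.+1) (m0 * 2 ^ j)%:R * sbound gamma alpha c M wstar (m0 * 2 ^ j)
     <= N%:R * (1 + ln (N%:R / m0%:R) / ln 2
                + Num.sqrt (2 `^ alpha) / (Num.sqrt (2 `^ alpha) - 1)
                  * Num.sqrt (N%:R `^ alpha * M / (c * gamma)))
            * logfac alpha c wstar).
Proof.
move=> gamma0 alpha01 c0 M0 fmeas fint fconv fgrad glip wmin zmeas zind zlaw acc.
split; last by move=> q m0 m00 NE; exact: sum_gradient_evaluations.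
move=> m Sm Sn wm wm_star wn_star sn m0 SmE SnE sub hm hn _ Aint.
subst m; rewrite -SnE => hs.
have n0 : (0 < #|Sn|)%N by rewrite SnE muln_gt0.
have alpha0 : 0 < alpha by case/andP: alpha01; lra.
have twoa := powR2_gt1 alpha0.
set W := enorm wstar ^+ 2.
have W0 : 0 <= W by rewrite sqr_ge0.
pose r := 2 `^ alpha - 1 : R.
have r0 : 0 <= r by rewrite subr_ge0 ltW.
have rW0 : 0 <= r * (4 + c * W) by rewrite mulr_ge0// addr_ge0// mulr_ge0// ltW.
have C0 : 0 < 6 * 2 `^ alpha + (2 `^ alpha - 1) * (4 + c * W).
  by rewrite -/r; lra.
have [t0 tC] := sbound_contract M0 gamma0 c0 n0 C0 hs.
have Vm0 := @Vacc_gt0 _ gamma alpha gamma0 _ m0.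
have Vn0 := @Vacc_gt0 _ gamma alpha gamma0 _ n0.
have VmE : Vacc gamma alpha #|Sm| = (1 + r) * Vacc gamma alpha #|Sn|.
  by rewrite SnE /r addrC subrK; exact: Vacc_half.
set Vm := Vacc gamma alpha #|Sm| in Aint Vm0 VmE *.
set Vn := Vacc gamma alpha #|Sn| in Vn0 VmE *.
pose F S om := Rreg gamma alpha c f z S om.
pose D S := sup_deviation P f z S.
have D0 (S : {set 'I_N}) om : (0 <= D S om)%E by exact: sup_deviation_ge0.
have mD (S : {set 'I_N}) : measurable_fun setT (D S) by exact: measurable_sup_deviation.
have intD (S : {set 'I_N}) : (0 < #|S|)%N -> (\int[Pr]_om D S om <= (Vacc gamma alpha #|S|)%:E)%E.
  by move=> S0; exact: integral_sup_deviation_le.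
have leD (S : {set 'I_N}) om w : ((deviation P f z S om w)%:E <= D S om)%E.
  exact: (le_sup_deviation M0 fint fconv fgrad glip).
pose K := r * Vn * (c / 2 * W).
have c20 : 0 <= c / 2 by rewrite divr_ge0// ltW.
have K0 : 0 <= K := mulr_ge0 (mulr_ge0 r0 (ltW Vn0)) (mulr_ge0 c20 W0).
have dE : #|Sn :\: Sm| = #|Sm|.
  by rewrite cardsD (finset.setIidPr sub) SnE mul2n -addnn addnK.
(* The error terms stay in the extended reals, as [D] may be infinite at some outcomes; there [gap]
   is trivial. *)
pose B om := ((D (Sn :\: Sm) om + D Sm om) + (K%:E + (2 * r)%:E * D Sn om))%E.
have r20 : 0 <= 2 * r by rewrite mulr_ge0.
have rD0 om : (0 <= (2 * r)%:E * D Sn om)%E by rewrite mule_ge0.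
have KD0 om : (0 <= K%:E + (2 * r)%:E * D Sn om)%E by rewrite adde_ge0// lee_fin.
have DD0 om : (0 <= D (Sn :\: Sm) om + D Sm om)%E by rewrite adde_ge0.
have mrD : measurable_fun setT (fun om => (2 * r)%:E * D Sn om)%E.
  exact: measurable_funeM.
have mKD : measurable_fun setT (fun om => K%:E + (2 * r)%:E * D Sn om)%E.
  exact: emeasurable_funD.
have mDD : measurable_fun setT (fun om => D (Sn :\: Sm) om + D Sm om)%E.
  exact: emeasurable_funD.
pose A om := (F Sm om (wm om) - F Sm om (wm_star om))%:E.
have gap om : ((F Sn om (wm om) - F Sn om (wn_star om))%:E <= A om + B om)%E.
  move: (leD (Sn :\: Sm) om) (leD Sm om) (leD Sn om).
  move: (D0 (Sn :\: Sm) om) (D0 Sm om) (D0 Sn om).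
  have r2 : (0 < (2 * r)%:E)%E by rewrite lte_fin mulr_gt0// subr_gt0.
  rewrite /A /B; case: (D (Sn :\: Sm) om) => [d| |]//; case: (D Sm om) => [dm| |]//;
    case: (D Sn om) => [dn| |]// _ _ _ hd hdm hdn; rewrite ?(gt0_muley r2)/= ?leey//.
  rewrite lee_fin.
  exact: suboptimality_transfer.
pose theta := Num.sqrt (c * Vn) / Num.sqrt (c * Vn + M).
pose q := 2 * (1 - theta) ^+ sn.
have q0 : 0 < q by rewrite mulr_gt0.
(* Only [B] has been shown measurable, while [A] involves an arbitrary choice of minimizers; the
   integral is therefore split by subadditivity of lower integrals. *)
apply: (@le_trans _ _ (q%:E * (\int[Pr]_om A om + \int[Pr]_om B om))%E).
  apply: le_lower_integralD => //.
  - by move=> om; rewrite lee_fin subr_ge0.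
  - by move=> om; rewrite lee_fin subr_ge0.
  - by move=> om; rewrite adde_ge0.
  - exact: emeasurable_funD.
  - move=> om; apply: (@le_trans _ _ (q * (F Sn om (wm om) - F Sn om (wn_star om)))%:E).
      rewrite lee_fin; exact: agd_Rreg_le.
    by rewrite EFinM lee_pmul2l// gap.
have intB : (\int[Pr]_om B om <= (Vm + Vm + (K + 2 * r * Vn))%:E)%E.
  rewrite ge0_integralD// ge0_integralD// ge0_integralD// ge0_integralZl_EFin//.
  rewrite integral_cst// [X in (K%:E * X)%E](probability_setT Pr) mule1.
  rewrite !EFinD (EFinM (2 * r)); apply: leeD; apply: leeD => //.
  - by rewrite /Vm -dE; apply: intD; rewrite dE.
  - exact: intD.
  - by apply: lee_wpmul2l => //; exact: intD.
apply: (@le_trans _ _ (q%:E * (Vm%:E + (Vm + Vm + (K + 2 * r * Vn))%:E))%E).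
  by rewrite lee_pmul2l// leeD.
rewrite -EFinD -EFinM lee_fin.
(* With Vm = 2^alpha Vn, the factor 2 in [q] turns 3 * 2^alpha + r (2 + c W / 2) into the argument
   of the logarithm, which [tC] then absorbs. *)
have -> : q * (Vm + (Vm + Vm + (K + 2 * r * Vn))) =
  ((1 - theta) ^+ sn * (6 * 2 `^ alpha + (2 `^ alpha - 1) * (4 + c * W))) * Vn.
  by rewrite VmE /q /K /r; field.
by rewrite -[leRHS]mul1r ler_wpM2r// ltW.
Qed.
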